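(* Let $(J,\Lambda,E)$ be a Jacobi manifold, $H\in C^\infty(J)$, and let $P=J\times\mathbb R^\times$ with Poisson bivector $\Pi=\frac1t\Lambda+\frac{\partial}{\partial t}\wedge E$, action $h_z(x,t)=(x,zt)$ ($z\in\mathbb R^\times$), and Poissonized Hamiltonian $\hat H=tH$. Let $k\ge1$ and let $\varphi=(\varphi_\epsilon)_{\epsilon\in I}$ be a Jacobi Hamiltonian integrator of order $k$ for $H$, regarded on $P$ as a homogeneous Poisson Hamiltonian integrator of order $k$ for $\hat H$. Then $\varphi$ preserves the homogeneous Poisson structure, and preserves the level sets of $\hat H$ and the Casimir functions up to order $k$. That is: 1. for every $\epsilon\in I$ and $z\in\mathbb R^\times$, $(\varphi_\epsilon)_*\Pi=\Pi$ and $\varphi_\epsilon\circ h_z=h_z\circ\varphi_\epsilon$; 2. for every $p\in P$, $\hat H(\varphi_\epsilon(p))=\hat H(p)+o(\epsilon^k)$ as $\epsilon\to0$; 3. for every Casimir function $C$ of $\Pi$ and every $p\in P$, $C(\varphi_\epsilon(p))=C(p)+o(\epsilon^k)$ as $\epsilon\to0$.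
   Context: A Jacobi manifold $(J,\Lambda,E)$ is a smooth manifold $J$ with a bivector field $\Lambda$ and a vector field $E$ such that $[\Lambda,\Lambda]=2E\wedge\Lambda$ and $[E,\Lambda]=0$. The Jacobi Hamiltonian vector field of $H\in C^\infty(J)$ is $X_H=\Lambda(\cdot,dH)-HE$. On $P=J\times\mathbb R^\times$ ($\mathbb R^\times=\mathbb R\setminus\{0\}$, coordinate $t$), $\Pi=\frac1t\Lambda+\frac{\partial}{\partial t}\wedge E$ is a Poisson structure, $\hat H=tH$ satisfies $\hat H\circ h_z=z\hat H$, and the Hamiltonian vector field $X_{\hat H}=\Pi(\cdot,d\hat H)$ projects to $X_H$ on $J$. A function $C\in C^\infty(P)$ is a Casimir function of $\Pi$ if $\Pi(\cdot,dC)=0$. A numerical integrator on a manifold $M$ is a smooth family of diffeomorphisms $\varphi=(\varphi_\epsilon)_{\epsilon\in I}$ of $M$, with $I\subset\mathbb R$ an interval containing $0$. It has order $k$ with respect to a vector field $X$ if, for all $x$, $\varphi_\epsilon(x)=\phi_X^\epsilon(x)+o(\epsilon^k)$ as $\epsilon\to0$ (in local coordinates), where $\phi^\epsilon_X$ is the flow of $X$. Given a Poisson (resp. Jacobi) manifold and a Hamiltonian $H$ with Hamiltonian vector field $X_H$ and flow $\phi_H^\epsilon$, an integrator $\varphi_\epsilon$ of order $k$ for $X_H$ is a Poisson (resp. Jacobi) Hamiltonian integrator of order $k$ for $H$ if each $\varphi_\epsilon$ is a Poisson (resp. Jacobi) diffeomorphism and there is a time-dependent Hamiltonian $(H_s)_s$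 (whose time-$\epsilon$ flow is $\varphi_\epsilon$) with $H_s-H=o(\epsilon^k)$, where $\epsilon$ is the time parameter, and $\varphi_\epsilon=\phi^\epsilon_H+o(\epsilon^k)$. On $P$, a Poisson Hamiltonian integrator is called homogeneous if it also preserves the homogeneous structure, i.e. $\varphi_\epsilon\circ h_z=h_z\circ\varphi_\epsilon$ for all $z\in\mathbb R^\times$. Jacobi Hamiltonian integrators of order $k$ for $H$ on $J$ correspond one-to-one to homogeneous Poisson Hamiltonian integrators of order $k$ for $\hat H$ on $P$, and this identification is used in the claim. *)

(* Defs.v *)
From mathcomp Require Import all_boot all_order all_algebra.
From mathcomp Require Import all_classical all_reals all_analysis.
Import Order.TTheory GRing.Theory Num.Theory.
Import numFieldNormedType.Exports.

Set Implicit Arguments.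
Unset Strict Implicit.
Unset Printing Implicit Defensive.

Local Open Scope classical_set_scope.
Local Open Scope ring_scope.

Section Calculus.
Context {R : realType}.

Fixpoint Ck (n k : nat) (U : set 'rV[R]_n) (f : 'rV[R]_n -> R) : Prop :=
  if k is k'.+1 then
    forall i : 'I_n,
      (forall v, U v -> derivable f v (delta_mx 0 i)) /\
      Ck k' U (fun v => 'D_(delta_mx 0 i) f v)
  else forall v, U v -> {for v, continuous f}.

Definition Cinf (n : nat) (U : set 'rV[R]_n) (f : 'rV[R]_n -> R) : Prop :=
  forall k, Ck k U f.

(* [g e = o(e^k)] as [e] tends to [0] inside [I]. *)
Definition littleo_pow (I : interval R) (k : nat) (g : R -> R) : Prop :=
  let F := within [set` I] (nbhs (0 : R)) in g =o_F (fun e : R => e ^+ k).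

End Calculus.

Section Manifolds.
Context {R : realType}.

Record chart (T : Type) (n : nat) := Chart {
  cdom : set T;
  cmap : T -> 'rV[R]_n;
  cinv : 'rV[R]_n -> T }.

(* Carrier and atlas only: the topology is the one generated by the charts, and
   the axioms are in [is_smooth_manifold]. *)
Record manifold := Manifold {
  carrier :> Type;
  mdim : nat;
  atlas : set (chart carrier mdim) }.

Definition mopen (M : manifold) (A : set M) : Prop :=
  forall c, atlas c -> open (cmap c @` (cdom c `&` A)).

Definition is_smooth_manifold (M : manifold) : Prop :=
  [/\ (forall x : M, exists2 c, atlas c & cdom c x),
      (forall c : chart M (mdim M), atlas c ->
         open (cmap c @` cdom c) /\
         (forall x, cdom c x -> cinv c (cmap c x) = x)),
      (forall c d : chart M (mdim M), atlas c -> atlas d ->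
         open (cmap c @` (cdom c `&` cdom d)) /\
         (forall i, Cinf (cmap c @` (cdom c `&` cdom d))
                         (fun v => cmap d (cinv c v) 0 i))),
      (forall x y : M, x <> y -> exists A B : set M,
         [/\ mopen A, mopen B, A x, B y & A `&` B = set0]) &
      (exists B : nat -> set M, (forall j, mopen (B j)) /\
         (forall A x, mopen A -> A x -> exists j, B j x /\ B j `<=` A))].

Definition prod_chart (T T' : Type) (m n : nat)
    (c : chart T m) (d : chart T' n) : chart (T * T') (m + n) :=
  Chart [set p | cdom c p.1 /\ cdom d p.2]
        (fun p => row_mx (cmap c p.1) (cmap d p.2))
        (fun v => (cinv c (lsubmx v), cinv d (rsubmx v))).

Definition prod_manifold (M N : manifold) : manifold :=
  @Manifold (M * N)%type (mdim M + mdim N)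
    [set e | exists c d, [/\ atlas c, atlas d & e = prod_chart c d]].

Definition line : manifold :=
  @Manifold R 1 [set Chart setT (fun x => const_mx x) (fun v => v 0 0)].

Definition Rstar : Type := {t : R | t != 0}.
Definition Rstar1 : Rstar := exist _ 1 (oner_neq0 R).
Definition Rstar_mul (z t : Rstar) : Rstar :=
  exist _ (val z * val t) (mulf_neq0 (valP z) (valP t)).

Definition Rstar_manifold : manifold :=
  @Manifold Rstar 1
    [set Chart setT (fun t => const_mx (val t))
                    (fun v => insubd Rstar1 (v 0 0))].

(* Smoothness on an arbitrary subset [A]: local extendability, in charts, to a
   C^oo map. Time-dependent objects over a possibly non-open interval [I] are
   smooth maps on the subset [I x M] of [R x M]. *)
Definition smooth_on (M N : manifold) (A : set M) (F : M -> N) : Prop :=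
  forall p, A p -> exists c d W (G : 'rV[R]_(mdim M) -> 'rV[R]_(mdim N)),
    [/\ (atlas c /\ cdom c p),
        (atlas d /\ cdom d (F p)),
        (open W /\ W (cmap c p)),
        (forall i, Cinf W (fun v => G v 0 i)) &
        (forall q, A q -> cdom c q -> W (cmap c q) ->
           cdom d (F q) /\ cmap d (F q) = G (cmap c q))].

Definition smooth_map (M N : manifold) (F : M -> N) : Prop :=
  smooth_on setT F.

Definition smooth (M : manifold) (f : M -> R) : Prop :=
  @smooth_map M line f.

Record diffeo (M : manifold) := Diffeo {
  dfun :> M -> M;
  dinv : M -> M;
  dfunK : cancel dfun dinv;
  dinvK : cancel dinv dfun;
  smooth_dfun : smooth_map dfun;
  smooth_dinv : smooth_map dinv }.

(* Vector fields and bivector fields are represented by their action on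
   functions, [X f = df(X)] and [L f g = L(df, dg)]; only the values on smooth
   functions matter. In each chart they are given by smooth components. *)
Definition op1 (M : manifold) : Type := (M -> R) -> (M -> R).
Definition op2 (M : manifold) : Type := (M -> R) -> (M -> R) -> (M -> R).

Definition cpartial (M : manifold) (c : chart M (mdim M)) (i : 'I_(mdim M))
    (f : M -> R) (x : M) : R :=
  'D_(delta_mx 0 i) (f \o cinv c) (cmap c x).

Definition is_vector_field (M : manifold) (X : op1 M) : Prop :=
  forall c : chart M (mdim M), atlas c ->
    exists xi : 'I_(mdim M) -> 'rV[R]_(mdim M) -> R,
      (forall i, Cinf (cmap c @` cdom c) (xi i)) /\
      (forall f x, smooth f -> cdom c x ->
         X f x = \sum_i xi i (cmap c x) * cpartial c i f x).

Definition is_bivector_field (M : manifold) (L : op2 M) : Prop :=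
  forall c : chart M (mdim M), atlas c ->
    exists la : 'I_(mdim M) -> 'I_(mdim M) -> 'rV[R]_(mdim M) -> R,
      [/\ (forall i j, Cinf (cmap c @` cdom c) (la i j)),
          (forall i j x, cdom c x ->
             la i j (cmap c x) = - la j i (cmap c x)) &
          (forall f g x, smooth f -> smooth g -> cdom c x ->
             L f g x = \sum_i \sum_j
               la i j (cmap c x) * cpartial c i f x * cpartial c j g x)].

Definition eq1 (M : manifold) (X Y : op1 M) : Prop :=
  forall f, smooth f -> X f =1 Y f.

Definition eq2 (M : manifold) (L L' : op2 M) : Prop :=
  forall f g, smooth f -> smooth g -> L f g =1 L' f g.

Definition push1 (M : manifold) (phi : diffeo M) (X : op1 M) : op1 M :=
  fun f => X (f \o phi) \o dinv phi.

Definition push2 (M : manifold) (phi : diffeo M) (L : op2 M) : op2 M :=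
  fun f g => L (f \o phi) (g \o phi) \o dinv phi.

(* Schouten brackets as brackets of skew multiderivations: [schouten12] is the
   Lie derivative, and [schouten22 L L f g h] is twice the Jacobiator
   L(L(f,g),h) + cyclic. With this sign, [L,L] = 2 E /\ L is what makes
   {f,g} = L(f,g) + f E(g) - g E(f) satisfy the Jacobi identity. *)
Definition schouten12 (M : manifold) (X : op1 M) (L : op2 M) : op2 M :=
  fun f g x => X (L f g) x - L (X f) g x - L f (X g) x.

Definition schouten22 (M : manifold) (L L' : op2 M) (f g h : M -> R) (x : M)
    : R :=
  L (L' f g) h x + L (L' g h) f x + L (L' h f) g x +
  (L' (L f g) h x + L' (L g h) f x + L' (L h f) g x).

Definition wedge12 (M : manifold) (X : op1 M) (L : op2 M) (f g h : M -> R)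
    (x : M) : R :=
  X f x * L g h x + X g x * L h f x + X h x * L f g x.

Definition is_jacobi (M : manifold) (L : op2 M) (E : op1 M) : Prop :=
  [/\ is_bivector_field L, is_vector_field E,
      (forall f g h x, smooth f -> smooth g -> smooth h ->
         schouten22 L L f g h x = 2 * wedge12 E L f g h x) &
      (forall f g x, smooth f -> smooth g -> schouten12 E L f g x = 0)].

Definition jacobi_ham (M : manifold) (L : op2 M) (E : op1 M) (H : M -> R)
    : op1 M :=
  fun f x => L f H x - H x * E f x.

Definition poisson_ham (M : manifold) (Pi : op2 M) (H : M -> R) : op1 M :=
  fun f => Pi f H.

Definition is_casimir (M : manifold) (Pi : op2 M) (C : M -> R) : Prop :=
  smooth C /\ (forall f p, smooth f -> Pi f C p = 0).

Definition poisson_diffeo (M : manifold) (Pi : op2 M) (phi : diffeo M) : Prop :=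
  eq2 (push2 phi Pi) Pi.

(* Jacobi diffeomorphisms are taken up to a conformal factor [a]: [phi] maps the
   conformally changed structure (a L, a E + L(da, .)) to (L, E). This is the
   class that contains the flows of Jacobi Hamiltonian vector fields, and it is
   equivalent to (x, t) |-> (phi x, a x * t) being a Poisson diffeomorphism of
   the Poissonization. *)
Definition jacobi_diffeo (M : manifold) (L : op2 M) (E : op1 M) (phi : diffeo M)
    : Prop :=
  exists a : M -> R,
    [/\ smooth a, (forall x, a x != 0),
        eq2 (push2 phi (fun f g x => a x * L f g x)) L &
        eq1 (push1 phi (fun f x => a x * E f x + L a f x)) E].

(* [gamma' s = X_s (gamma s)] for [s] in [I], one-sided at the end points that
   belong to [I]. *)
Definition integral_curve (M : manifold) (I : interval R) (X : R -> op1 M)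
    (gamma : R -> M) : Prop :=
  forall s, s \in I ->
    (forall A : set M, mopen A -> A (gamma s) ->
       \forall r \near within [set` I] (nbhs s), A (gamma r)) /\
    (forall f, smooth f ->
       (f (gamma (s + h)) - f (gamma s)) / h
         @[h --> within [set h | s + h \in I] (0 : R)^'] --> X s f (gamma s)).

Definition is_flow (M : manifold) (I : interval R) (X : R -> op1 M)
    (phi : R -> M -> M) : Prop :=
  forall x, phi 0 x = x /\ integral_curve I X (fun s => phi s x).

Definition smooth_family (M N : manifold) (I : interval R) (F : R -> M -> N)
    : Prop :=
  @smooth_on (prod_manifold line M) N [set q | q.1 \in I]
    (fun q => F q.1 q.2).

(* The values of [phi] outside [I] are irrelevant. *)
Definition integrator (M : manifold) (I : interval R) (phi : R -> diffeo M)
    : Prop :=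
  0 \in I /\ smooth_family I (fun e => phi e : M -> M).

(* [gamma] is the flow line e |-> phi_X^e(x), defined for small time. *)
Definition has_order (M : manifold) (I : interval R) (phi : R -> diffeo M)
    (k : nat) (X : op1 M) : Prop :=
  forall x, exists (delta : R) (gamma : R -> M) (c : chart M (mdim M)),
    [/\ 0 < delta,
        integral_curve `]- delta, delta[ (fun=> X) gamma /\ gamma 0 = x,
        atlas c /\ cdom c x,
        (\forall e \near within [set` I] (nbhs (0 : R)),
           cdom c (phi e x) /\ cdom c (gamma e)) &
        (forall i, littleo_pow I k
           (fun e => cmap c (phi e x) 0 i - cmap c (gamma e) 0 i))].

Definition hamiltonian_integrator (M : manifold) (ham : (M -> R) -> op1 M)
    (iso : diffeo M -> Prop) (I : interval R) (k : nat) (H : M -> R)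
    (phi : R -> diffeo M) : Prop :=
  [/\ integrator I phi,
      has_order I phi k (ham H),
      (forall e, e \in I -> iso (phi e)) &
      exists Hs : R -> M -> R,
        [/\ @smooth_family M line I Hs,
            (forall x, littleo_pow I k (fun s => Hs s x - H x)) &
            is_flow I (fun s => ham (Hs s)) (fun e => phi e : M -> M)]].

Definition poisson_hamiltonian_integrator (M : manifold) (Pi : op2 M) :=
  hamiltonian_integrator (poisson_ham Pi) (poisson_diffeo Pi).

Definition jacobi_hamiltonian_integrator (M : manifold) (L : op2 M) (E : op1 M) :=
  hamiltonian_integrator (jacobi_ham L E) (jacobi_diffeo L E).

Definition poissonization (J : manifold) : manifold :=
  prod_manifold J Rstar_manifold.

Definition hact (J : manifold) (z : Rstar) (p : poissonization J)
    : poissonization J :=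
  (p.1, Rstar_mul z p.2).

Definition partial_t (J : manifold) (f : poissonization J -> R)
    (p : poissonization J) : R :=
  derive1 (fun s : R => f (p.1, insubd p.2 s)) (val p.2).

Definition slice (J : manifold) (f : poissonization J -> R) (t : Rstar) : J -> R :=
  fun x => f (x, t).

(* (1/t) L + d/dt /\ E, where [L] and [E] act on the J-variable. *)
Definition poisson_bivector (J : manifold) (L : op2 J) (E : op1 J)
    : op2 (poissonization J) :=
  fun f g p =>
    (val p.2)^-1 * L (slice f p.2) (slice g p.2) p.1 +
    (partial_t f p * E (slice g p.2) p.1 - E (slice f p.2) p.1 * partial_t g p).

Definition poissonized_ham (J : manifold) (H : J -> R) : poissonization J -> R :=
  fun p => val p.2 * H p.1.

Definition homogeneous_poisson_hamiltonian_integrator (J : manifold)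
    (L : op2 J) (E : op1 J) (I : interval R) (k : nat)
    (Hhat : poissonization J -> R) (Phi : R -> diffeo (poissonization J))
    : Prop :=
  poisson_hamiltonian_integrator (poisson_bivector L E) I k Hhat Phi /\
  (forall e z p, e \in I -> Phi e (hact z p) = hact z (Phi e p)).

(* [Phi] is [phi] regarded on the Poissonization: by homogeneity each [Phi e] is
   then of the form (x, t) |-> (phi e x, a e x * t). *)
Definition covers (J : manifold) (I : interval R) (phi : R -> diffeo J)
    (Phi : R -> diffeo (poissonization J)) : Prop :=
  forall e p, e \in I -> (Phi e p).1 = phi e p.1.

End Manifolds.

Arguments manifold R : clear implicits.
Arguments line R : clear implicits.
Arguments Rstar R : clear implicits.

(* Main.v *)
(* Only claims 2 and 3 need an argument. A smooth function f with X_Hhat f = 0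
   is constant along the exact trajectory gamma of X_Hhat; by skew-symmetry of
   Pi this applies both to f = Hhat and to every Casimir function. In a chart, f
   is locally Lipschitz (it is C^1), and the integrator agrees with gamma up to
   o(e^k) in coordinates, so f (Phi e p) - f p = f (Phi e p) - f (gamma e) is
   o(e^k) as well. *)
Require Import Defs.
From mathcomp Require Import all_boot all_order all_algebra.
From mathcomp Require Import all_classical all_reals all_analysis.
From mathcomp Require Import ring lra.
Import Order.TTheory GRing.Theory Num.Theory.
Import numFieldNormedType.Exports.

Set Implicit Arguments.
Unset Strict Implicit.
Unset Printing Implicit Defensive.

Local Open Scope classical_set_scope.
Local Open Scope ring_scope.

(** * Differential calculus on row vectors: closure of C^oo functions and local Lipschitz bounds *)

Section Calculus.
Context {R : realType}.

(** The endpoints come in either order because coordinate increments and times may be negative; the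
    ordered case is the mean value theorem. *)
Lemma mvt_norm_le (g : R -> R) (a b M : R) :
  (forall x, (a <= x <= b) || (b <= x <= a) ->
     derivable g x 1 /\ `|'D_1 g x| <= M) ->
  `|g b - g a| <= M * `|b - a|.
Proof.
wlog ab : a b / a <= b => [hw gM|gM].
  have [ab|/ltW ba] := leP a b; first exact: hw.
  by rewrite distrC (distrC b); apply: hw => // x; rewrite orbC; exact: gM.
have gM' x : x \in `[a, b] -> derivable g x 1 /\ `|'D_1 g x| <= M.
  by rewrite in_itv/= => xab; apply: gM; rewrite xab.
have [||c cab ->] := @MVT_segment R g ('D_1 g) a b ab.
- move=> x xab; have [|gx _] := gM' x; first exact: subset_itv_oo_cc xab.
  exact/derivableP.
- apply: derivable_within_continuous => x xab; exact: (gM' x xab).1.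
- by rewrite normrM ler_wpM2r// (gM' c cab).2.
Qed.

Lemma Ck_subset n k (U V : set 'rV[R]_n) f : V `<=` U -> Ck k U f -> Ck k V f.
Proof.
move=> VU; elim: k f => [|k IHk] f /= fU; first by move=> v /VU; exact: fU.
by move=> i; have [df Df] := fU i; split=> [v /VU|]; [exact: df|exact: IHk].
Qed.

Lemma Cinf_subset n (U V : set 'rV[R]_n) f : V `<=` U -> Cinf U f -> Cinf V f.
Proof. by move=> VU fU k; apply: Ck_subset VU (fU k). Qed.

(** Since [U] is open, agreement on [U] is agreement near each of its points, which is all that
    limits and directional derivatives see. *)
Lemma Ck_ext n k (U : set 'rV[R]_n) f g :
  open U -> {in U, f =1 g} -> Ck k U f -> Ck k U g.
Proof.
move=> Uo; elim: k f g => [|k IHk] f g fg /= fU.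
  move=> v Uv; have fgv : {near v, f =1 g}.
    by apply: filterS (open_nbhs_nbhs (conj Uo Uv)) => w Uw; apply/fg/mem_set.
  suff : g x @[x --> v] --> f v by rewrite (fg v (mem_set Uv)).
  apply: cvg_trans (fU v Uv).
  exact: near_eq_cvg fgv.
have near_fg v : U v -> {near v, f =1 g}.
  by move=> Uv; apply: filterS (open_nbhs_nbhs (conj Uo Uv)) => w Uw;
    apply/fg/mem_set.
move=> i; have [df Df] := fU i; split=> [v Uv|].
  exact: near_eq_derivable (near_fg v Uv) (df v Uv).
apply: IHk Df => v /set_mem Uv; apply: near_eq_derive; exact: near_fg.
Qed.

Lemma Cinf_ext n (U : set 'rV[R]_n) f g :
  open U -> {in U, f =1 g} -> Cinf U f -> Cinf U g.
Proof. by move=> Uo fg fU k; apply: Ck_ext Uo fg (fU k). Qed.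

Lemma Cinf_continuous n (U : set 'rV[R]_n) f v :
  Cinf U f -> U v -> {for v, continuous f}.
Proof. by move=> fU; apply: (fU 0%N). Qed.

Lemma Cinf_derivable n (U : set 'rV[R]_n) f i v :
  Cinf U f -> U v -> derivable f v (delta_mx 0 i).
Proof. by move=> fU Uv; have [+ _] := fU 1%N i; apply. Qed.

Lemma Cinf_derive n (U : set 'rV[R]_n) f i :
  Cinf U f -> Cinf U ('D_(delta_mx 0 i) f).
Proof. by move=> fU k; have [_ +] := fU k.+1 i. Qed.

Lemma Cinf_cst n (U : set 'rV[R]_n) (c : R) : Cinf U (fun=> c).
Proof.
move=> k; elim: k c => [|k IHk] c /=.
  by move=> v _; exact: cst_continuous.
move=> i; split=> [v _|]; first exact: derivable_cst.
suff -> : (fun v : 'rV[R]_n => 'D_(delta_mx 0 i) (fun=> c) v) = fun=> 0.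
  exact: IHk.
by apply/funext => v; exact: derive_cst.
Qed.

Lemma Ck_add n k (U : set 'rV[R]_n) f g :
  open U -> Ck k U f -> Ck k U g -> Ck k U (fun v => f v + g v).
Proof.
move=> Uo; elim: k f g => [|k IHk] p q pU qU /=.
  by move=> v Uv; apply: continuousD; [exact: pU|exact: qU].
move=> i; have [dp Dp] := pU i; have [dq Dq] := qU i; split=> [v Uv|].
  by apply: derivableD; [exact: dp|exact: dq].
apply: Ck_ext (IHk _ _ Dp Dq) => // v /set_mem Uv.
by rewrite -[fun w => p w + q w]/(p + q) deriveD//; [exact: dp|exact: dq].
Qed.

(** The product rule brings back [f] and [g] themselves beside their derivatives, so the induction
    on [k] keeps both factors C^oo instead of lowering their order. *)
Lemma Cinf_mul n (U : set 'rV[R]_n) f g :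
  open U -> Cinf U f -> Cinf U g -> Cinf U (fun v => f v * g v).
Proof.
move=> Uo fU gU k; elim: k f g fU gU => [|k IHk] f g fU gU /=.
  by move=> v Uv; apply: continuousM; exact: Cinf_continuous Uv.
move=> i; split=> [v Uv|].
  by apply: derivableM; exact: Cinf_derivable Uv.
have Df := Cinf_derive i fU; have Dg := Cinf_derive i gU.
apply: Ck_ext (Ck_add Uo (IHk _ _ fU Dg) (IHk _ _ gU Df)) => // v.
move=> /set_mem Uv; rewrite -[fun w => _]/(f * g).
by rewrite deriveM//; exact: Cinf_derivable Uv.
Qed.

(* Along such a map the difference quotients of [f \o A] are literally those of
   [f], so no chain rule is needed. *)
Definition coordinate_affine m n (A : 'rV[R]_m -> 'rV[R]_n) :=
  forall i, (exists j : 'I_n, forall v h,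
      A (h *: delta_mx 0 i + v) = h *: delta_mx 0 j + A v) \/
    (forall v h, A (h *: delta_mx 0 i + v) = A v).

(** A partial derivative of [f \o A] is either zero or a partial derivative of [f] composed with
    [A], so the induction closes on itself. *)
Lemma Cinf_comp_affine m n (A : 'rV[R]_m -> 'rV[R]_n) (U : set 'rV[R]_n) f :
  continuous A -> coordinate_affine A -> Cinf U f -> Cinf (A @^-1` U) (f \o A).
Proof.
move=> Ac Aa fU k; elim: k f fU => [|k IHk] f fU /=.
  by move=> v Uv; apply: continuous_comp (Cinf_continuous fU Uv); exact: Ac.
move=> i; have [[j Aj]|A0] := Aa i.
  have quot v :
      (fun h => h^-1 *: ((f \o A) (h *: delta_mx 0 i + v) - (f \o A) v)) =
      (fun h => h^-1 *: (f (h *: delta_mx 0 j + A v) - f (A v))).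
    by apply/funext => h /=; rewrite Aj.
  split=> [v Uv|].
    have := Cinf_derivable (i := j) fU Uv.
    by rewrite /derivable /= -quot.
  have -> : 'D_(delta_mx 0 i) (f \o A) = 'D_(delta_mx 0 j) f \o A.
    by apply/funext => v; rewrite /derive /= -quot.
  exact/IHk/Cinf_derive.
have quot v :
    (fun h => h^-1 *: ((f \o A) (h *: delta_mx 0 i + v) - (f \o A) v)) =
    fun=> 0.
  by apply/funext => h /=; rewrite A0 subrr scaler0.
split=> [v Uv|]; first by rewrite /derivable /= quot; exact: is_cvg_cst.
have -> : 'D_(delta_mx 0 i) (f \o A) = fun=> 0.
  by apply/funext => v; rewrite /derive /= quot; exact: lim_cst.
exact: Cinf_cst.
Qed.

(** The l^1 distance matches errors that are controlled one coordinate at a time, as in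
    [has_order]. *)
Definition lipschitz_near n (f : 'rV[R]_n -> R) (v0 : 'rV[R]_n) :=
  exists K r, [/\ 0 <= K, 0 < r & forall u v, ball v0 r u -> ball v0 r v ->
    `|f u - f v| <= K * \sum_i `|u 0 i - v 0 i|].

(** The continuous partial derivatives are bounded near [v0]; passing from [v] to [u] one coordinate
    at a time reduces the estimate to the mean value theorem in one variable. *)
Lemma Cinf_lipschitz n (U : set 'rV[R]_n) f v0 :
  open U -> Cinf U f -> U v0 -> lipschitz_near f v0.
Proof.
move=> Uo fU Uv0.
have bnd i : exists M : R, \forall v \near v0, `|'D_(delta_mx 0 i) f v| <= M.
  have Dc := Cinf_continuous (Cinf_derive i fU) Uv0.
  exists (`|'D_(delta_mx 0 i) f v0| + 1).
  move/cvgr_dist_le: Dc => /(_ 1 ltr01); apply: filterS => v vM.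
  rewrite -lerBlDl; apply: le_trans (lerB_dist _ _) _.
  by rewrite distrC.
have [M0 M0P] := choice bnd.
pose M := \sum_i `|M0 i|.
have M_ge0 : 0 <= M by rewrite sumr_ge0.
have /nbhs_ballP[r r0 rP] : \forall v \near v0,
    U v /\ forall i, `|'D_(delta_mx 0 i) f v| <= M.
  apply: filterS2 (open_nbhs_nbhs (conj Uo Uv0)) _; last first.
    apply: filter_forall M0P.
  move=> v Uv vM; split=> // i; apply: le_trans (vM i) _.
  apply: le_trans (ler_norm _) _; rewrite /M (bigD1 i)//= lerDl.
  by rewrite sumr_ge0.
(* Each of the [n] coordinate changes costs at most [M] times the whole l^1 distance. *)
exists (n%:R * M), r; split => //; first by rewrite mulr_ge0.
move=> u v [_ ru] [_ rv].
set S := \sum_i _; have S0 : 0 <= S by rewrite sumr_ge0.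
(* The staircase from [v] to [u]: the first [j] coordinates are already those of [u]. *)
pose w j : 'rV[R]_n := \row_i (if (i < j)%N then u 0 i else v 0 i).
have wn : w n = u by apply/rowP => i; rewrite mxE ltn_ord.
have w0 : w 0%N = v by apply/rowP => i; rewrite mxE.
suff wj j : (j <= n)%N -> `|f (w j) - f v| <= j%:R * M * S.
  by rewrite -wn; exact: wj.
elim: j => [|j IHj] jn; first by rewrite w0 subrr normr0 !mul0r.
pose jj := Ordinal jn; pose e : 'rV[R]_n := delta_mx 0 jj.
pose g (h : R) := f (h *: e + w j).
have gu : g (u 0 jj - v 0 jj) = f (w j.+1).
  congr f; apply/rowP => i; rewrite !mxE eqxx /= ltnS.
  have [->|ij] := eqVneq i jj; first by rewrite leqnn ltnn mulr1 subrK.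
  by rewrite mulr0 add0r [in RHS]leq_eqVlt; rewrite -val_eqE in ij;
    rewrite (negbTE ij).
have g0 : g 0 = f (w j) by rewrite /g scale0r add0r.
have gM : `|g (u 0 jj - v 0 jj) - g 0| <= M * `|u 0 jj - v 0 jj - 0|.
  apply: mvt_norm_le => h h_in.
  have [Uh Mh] : U (h *: e + w j) /\
      forall i, `|'D_(delta_mx 0 i) f (h *: e + w j)| <= M.
    (* Balls of the sup norm are boxes, so the segments of the staircase stay inside the ball. *)
    apply: rP; split => // a b; rewrite ord1 !mxE eqxx /=.
    have [->|bj] := eqVneq b jj; last first.
      by rewrite mulr0 add0r; case: ifP => _; [exact: ru|exact: rv].
    rewrite ltnn mulr1; move: (ru 0 jj) (rv 0 jj).
    rewrite /ball /= !ltr_norml => /andP[? ?] /andP[? ?].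
    by case/orP: h_in => /andP[? ?]; apply/andP; split; lra.
  have quot : (fun t => t^-1 *: (g (t *: 1 + h) - g h)) =
      (fun t => t^-1 *: (f (t *: e + (h *: e + w j)) - f (h *: e + w j))).
    apply/funext => t; rewrite /g addrA -scalerDl.
    by rewrite /GRing.scale /= mulr1.
  split.
    by rewrite /derivable quot; exact: (Cinf_derivable (i := jj) fU Uh).
  by rewrite /derive quot; exact: Mh.
rewrite gu g0 subr0 in gM.
rewrite -(subrKA (f (w j))) (le_trans (ler_normD _ _))//.
rewrite -natr1 mulrDl mul1r mulrDl [leRHS]addrC.
apply: lerD; last exact/IHj/ltnW.
apply: le_trans gM _; rewrite ler_wpM2l// /S (bigD1 jj)//= lerDl.
by rewrite sumr_ge0.
Qed.

End Calculus.

(** * Smooth functions in charts and first integrals along approximate flows *)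

Section Charts.
Context {R : realType}.

Lemma rV_continuous m n (T : 'rV[R]_m -> 'rV[R]_n) (v : 'rV[R]_m) :
  (forall i, {for v, continuous (fun w => T w 0 i)}) -> {for v, continuous T}.
Proof.
move=> Tc A /= /nbhs_ballP[r r0 rA].
have near_i i : \forall w \near v, ball (T v 0 i) r (T w 0 i).
  exact: (Tc i (ball (T v 0 i) r) (nbhsx_ballx _ _ r0)).
apply: filterS (filter_forall _ near_i) => w Tw; apply: rA.
by split=> // i j; rewrite ord1; exact: Tw.
Qed.

(** The chart axioms are isolated because they pass directly from two factors to their product. *)
Definition smooth_atlas (M : manifold R) : Prop :=
  (forall c : chart M (mdim M), atlas c ->
     forall x, cdom c x -> cinv c (cmap c x) = x) /\
  (forall c d : chart M (mdim M), atlas c -> atlas d ->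
     open (cmap c @` (cdom c `&` cdom d)) /\
     (forall i, Cinf (cmap c @` (cdom c `&` cdom d))
                     (fun v => cmap d (cinv c v) 0 i))).

Lemma smooth_manifold_atlas (M : manifold R) :
  is_smooth_manifold M -> smooth_atlas M.
Proof. by case=> _ Mc Mt _ _; split=> // c /Mc[]. Qed.

Lemma transition_continuous (M : manifold R) (c d : chart M (mdim M)) v :
  smooth_atlas M -> atlas c -> atlas d -> (cmap c @` (cdom c `&` cdom d)) v ->
  {for v, continuous (fun w => cmap d (cinv c w))}.
Proof.
move=> [_ Mt] Mc Md Uv; have [_ T] := Mt c d Mc Md.
by apply: rV_continuous => i; exact: Cinf_continuous (T i) Uv.
Qed.

(** Openness is tested in every chart [d], where the set is the preimage of [V] under the continuous
    transition from [d] to [c]. It turns the continuity clause of [integral_curve] into a statement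
    in coordinates. *)
Lemma mopen_chart (M : manifold R) (c : chart M (mdim M)) V :
  smooth_atlas M -> atlas c -> open V ->
  mopen [set y : M | cdom c y /\ V (cmap c y)].
Proof.
move=> Matl Mc Vo d Md.
have [Minv Mt] := Matl.
have [Uo _] := Mt d c Md Mc.
rewrite openE => w [y [dy [cy Vy]] <-{w}].
have Uy : (cmap d @` (cdom d `&` cdom c)) (cmap d y) by exists y.
have Tc := transition_continuous Matl Md Mc Uy.
have VT : \forall w \near cmap d y, V (cmap c (cinv d w)).
  apply: Tc; rewrite /= Minv//; exact: open_nbhs_nbhs.
rewrite /interior /=.
apply: filterS2 (open_nbhs_nbhs (conj Uo Uy)) VT => w [z [dz cz] <-].
by rewrite Minv// => Vz; exists z.
Qed.

(** Smoothness yields a representative [G] in some chart [d], not in the given [c]. Composing the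
    Lipschitz bound of [G] with those of the transition coordinates avoids a chain rule. *)
Lemma smooth_chart_lipschitz (M : manifold R) f (c : chart M (mdim M)) x :
  smooth_atlas M -> smooth f -> atlas c -> cdom c x ->
  exists K r, [/\ 0 <= K, 0 < r & forall y z, cdom c y -> cdom c z ->
    ball (cmap c x) r (cmap c y) -> ball (cmap c x) r (cmap c z) ->
    `|f y - f z| <= K * \sum_i `|cmap c y 0 i - cmap c z 0 i|].
Proof.
move=> Matl fs Mc cx.
have [d [_ [W [G [[Md dx] [-> _] [Wo Wx] Gs fG]]]]] := fs x I.
have [Minv Mt] := Matl.
have [Uo Ts] := Mt c d Mc Md.
set U := cmap c @` _ in Uo Ts.
have Ux : U (cmap c x) by exists x.
have [KG [rG [KG0 rG0 GL]]] := Cinf_lipschitz Wo (Gs 0) Wx.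
have /choice[KT KTP] : forall i, exists K : R, 0 <= K /\
    exists r, 0 < r /\ forall u v, ball (cmap c x) r u -> ball (cmap c x) r v ->
    `|cmap d (cinv c u) 0 i - cmap d (cinv c v) 0 i|
      <= K * \sum_j `|u 0 j - v 0 j|.
  move=> i; have [K [r [K0 r0 KL]]] := Cinf_lipschitz Uo (Ts i) Ux.
  by exists K; split => //; exists r.
have /choice[rT rTP] := fun i => (KTP i).2.
have Tc := transition_continuous Matl Mc Md Ux.
have /nbhs_ballP[r r0 rP] : \forall v \near cmap c x,
    (U v /\ forall i, ball (cmap c x) (rT i) v) /\
    (W (cmap d (cinv c v)) /\ ball (cmap d x) rG (cmap d (cinv c v))).
  apply: filterI.
  - apply: filterI; first exact: open_nbhs_nbhs.
    have near_i i : \forall v \near cmap c x, ball (cmap c x) (rT i) v.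
      by apply: nbhsx_ballx; have [] := rTP i.
    exact: filter_forall near_i.
  - apply: (Tc (W `&` ball (cmap d x) rG)); rewrite /= Minv//.
    apply: filterI; first exact: open_nbhs_nbhs.
    exact: nbhsx_ballx.
exists (KG * \sum_i KT i), r; split => //.
  by rewrite mulr_ge0// sumr_ge0// => i _; have [] := KTP i.
move=> y z cy cz ry rz.
(* Membership in [U] provides a point of both domains with the same coordinates in [c]; inverting
   the chart identifies it with [y]. *)
have [[[y' [cy' dy] /(congr1 (cinv c))]]] := rP _ ry.
rewrite !Minv// => y'y; subst y' => Ty [Wy Gy].
have [[[z' [cz' dz] /(congr1 (cinv c))]]] := rP _ rz.
rewrite !Minv// => z'z; subst z' => Tz [Wz Gz].
have fE w : cdom d w -> W (cmap d w) -> f w = G (cmap d w) 0 0.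
  by move=> dw Ww; have [_ <-] := fG w I dw Ww; rewrite /= mxE.
rewrite !fE// (le_trans (GL _ _ Gy Gz))// -mulrA ler_wpM2l// mulr_suml.
apply: ler_sum => i _; have [_ /(_ (cmap c y) (cmap c z))] := rTP i.
by rewrite !Minv//; apply.
Qed.

(** The derivative of [f \o gamma] is [X f] along [gamma], hence zero, and the mean value bound
    applies with constant 0. *)
Lemma first_integral_curve (M : manifold R) (X : op1 M) f delta gamma :
  smooth f -> (forall y, X f y = 0) ->
  integral_curve `]- delta, delta[ (fun=> X) gamma ->
  forall e, `|e| < delta -> f (gamma e) = f (gamma 0).
Proof.
move=> fs Xf gX e e_lt.
have g0 s : s \in `]- delta, delta[ ->
    (fun h => h^-1 *: (f (gamma (h *: 1 + s)) - f (gamma s))) @ 0^' --> (0 : R).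
  move=> sI; have [_ /(_ f fs)] := gX s sI; rewrite Xf.
  (* The interval is open, so its constraint on [h] holds for all small [h] and the restricted limit
     is an ordinary derivative. *)
  have sN : \forall h \near (0 : R)^', s + h \in `]- delta, delta[.
    apply: (@cvg_within _ (nbhs (0 : R))).
    have sh : (fun h => s + h) @ (0 : R) --> s.
      rewrite -[X in _ --> X]addr0.
      by apply: cvgD; [exact: cvg_cst|exact: cvg_id].
    exact: (sh _ (near_in_itvoo sI)).
  move=> fX; apply: cvg_trans fX.
  move=> A /= fA; apply: filterS2 sN fA => h hI /(_ hI).
  by rewrite /GRing.scale /= mulr1 mulrC (addrC h).
apply/eqP; rewrite -subr_eq0 -normr_le0 -[leRHS](mul0r `|e - 0|).
apply: (mvt_norm_le (g := f \o gamma)) => s se.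
have sI : s \in `]- delta, delta[.
  rewrite in_itv /=; move: e_lt; rewrite ltr_norml => /andP[? ?].
  by case/orP: se => /andP[? ?]; apply/andP; split; lra.
split; first by apply/cvg_ex; exists 0; exact: g0.
by rewrite /derive (cvg_lim _ (g0 s sI))// normr0.
Qed.

Lemma has_order_first_integral (M : manifold R) (X : op1 M) f
    (I : interval R) k (phi : R -> diffeo M) x :
  smooth_atlas M -> smooth f -> (forall y, X f y = 0) ->
  has_order I phi k X -> littleo_pow I k (fun e => f (phi e x) - f x).
Proof.
move=> Matl fs Xf /(_ x)[delta [gamma [c [d0 [gX g0] [Mc cx] near_c go]]]].
have [K [r [K0 r0 fL]]] := smooth_chart_lipschitz Matl fs Mc cx.
have nearI (P : set R) : (\forall e \near (0 : R), P e) ->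
    \forall e \near within [set` I] (nbhs (0 : R)), P e.
  exact: (@cvg_within _ (nbhs (0 : R))).
have fg : \forall e \near within [set` I] (nbhs (0 : R)), f (gamma e) = f x.
  apply: nearI; apply: filterS (nbhs0_lt d0) => e ed.
  by rewrite (first_integral_curve fs Xf gX ed) g0.
have gball : \forall e \near within [set` I] (nbhs (0 : R)),
    ball (cmap c x) (r / 2) (cmap c (gamma e)).
  apply: nearI.
  have I0 : (0 : R) \in `]- delta, delta[ by rewrite in_itv /= oppr_lt0 d0.
  (* Continuity of [gamma] at 0 is applied to the interior of the ball, because [mopen_chart] takes
     an open set. *)
  have [/(_ [set y |
    cdom c y /\ (ball (cmap c x) (r / 2))^° (cmap c y)]) + _] := gX 0 I0.
  have r20 : 0 < r / 2 by rewrite divr_gt0.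
  move=> /(_ (mopen_chart Matl Mc (@open_interior _ _))).
  rewrite g0 => /(_ (conj cx (nbhsx_ballx (cmap c x) _ r20))).
  rewrite /within /= => gnear.
  have dI : \forall e \near (0 : R), e \in `]- delta, delta[.
    exact: near_in_itvoo.
  apply: filterS2 dI gnear => e eI /(_ eI)[_]; exact: interior_subset.
rewrite /littleo_pow /=; apply/eqoP => eps eps0.
(* The coordinate errors add up to a factor [K * mdim M]; the added 1 keeps [C] positive when this
   vanishes. *)
pose C := K * (mdim M)%:R + 1.
have C0 : 0 < C by rewrite ltr_pwDr// mulr_ge0.
(* The first bound gives the final estimate; the second keeps the integrator within [r / 2] of
   [gamma], hence in the Lipschitz ball. *)
pose eps' := Num.min (eps / C) (r / 2).
have eps'0 : 0 < eps' by rewrite lt_min !divr_gt0.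
have coord : \forall e \near within [set` I] (nbhs (0 : R)), forall i,
    `|cmap c (phi e x) 0 i - cmap c (gamma e) 0 i| <= eps' / 2 * `|e ^+ k|.
  apply: filter_forall => i.
  have := go i; rewrite /littleo_pow /= => /eqoP; apply.
  by rewrite divr_gt0.
near=> e.
have e1 : `|e| <= 1.
  by near: e; apply: nearI; apply: filterS (nbhs0_lt ltr01) => e; exact: ltW.
have ek1 : `|e ^+ k| <= 1 by rewrite normrX exprn_ile1.
have fge : f (gamma e) = f x by near: e.
have [cp cg] : cdom c (phi e x) /\ cdom c (gamma e) by near: e.
have bg : ball (cmap c x) (r / 2) (cmap c (gamma e)) by near: e.
have coe : forall i,
    `|cmap c (phi e x) 0 i - cmap c (gamma e) 0 i| <= eps' / 2 * `|e ^+ k|.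
  by near: e.
(* As [e ^+ k] is at most 1 in norm, each error is at most [eps' / 2]; the halving makes it strictly
   less than [r / 2]. *)
have bp : ball (cmap c (gamma e)) (r / 2) (cmap c (phi e x)).
  split; first by rewrite divr_gt0.
  move=> a i; rewrite ord1 /ball /= distrC (le_lt_trans (coe i))//.
  rewrite (@le_lt_trans _ _ (eps' / 2))//.
    by rewrite -[leRHS]mulr1 ler_wpM2l// divr_ge0// ltW.
  rewrite (@lt_le_trans _ _ eps')// ?ge_min ?lexx ?orbT//.
  by rewrite ltr_pdivrMr// ltr_pMr// ltr1n.
rewrite -fge; apply: le_trans (fL _ _ cp cg _ _) _.
- by rewrite [r]splitr; exact: ball_triangle bg bp.
- by apply: le_ball bg; rewrite ler_pdivrMr// ler_peMr ?ltW// ltr1n.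
apply: (@le_trans _ _ (K * ((mdim M)%:R * (eps' * `|e ^+ k|)))).
  rewrite ler_wpM2l// mulr_natl -[X in _ <= _ *+ X]card_ord.
  rewrite -sumr_const; apply: ler_sum => i _; apply: le_trans (coe i) _.
  by rewrite ler_wpM2r// ler_pdivrMr// ler_peMr ?ltW// ltr1n.
rewrite !mulrA ler_wpM2r//.
apply: (@le_trans _ _ (C * eps')); first by rewrite ler_wpM2r ?ltW// /C ltrDl.
by rewrite mulrC -ler_pdivlMr// ge_min lexx.
Unshelve. all: by end_near.
Qed.

End Charts.

(** * Charts, smooth functions and skew-symmetry on the Poissonization *)

Section Poissonization.
Context {R : realType}.

(** A block projection sends each basis vector to a basis vector or to zero: the two cases of
    [coordinate_affine]. *)
Lemma lsubmx_affine m n : coordinate_affine (@lsubmx R 1 m n).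
Proof.
move=> i; case: (split_ordP i) => j ->; [left; exists j|right] => v h.
  by apply/rowP => l; rewrite !mxE eqxx /= (inj_eq (@lshift_inj _ _)).
by apply/rowP => l; rewrite !mxE eqxx /= eq_lrshift mulr0 add0r.
Qed.

Lemma rsubmx_affine m n : coordinate_affine (@rsubmx R 1 m n).
Proof.
move=> i; case: (split_ordP i) => j ->; [right|left; exists j] => v h.
  by apply/rowP => l; rewrite !mxE eqxx /= eq_rlshift mulr0 add0r.
by apply/rowP => l; rewrite !mxE eqxx /= (inj_eq (@rshift_inj _ _)).
Qed.

Lemma row_mx_rV_continuous m n (b : 'rV[R]_n) :
  continuous (fun v : 'rV[R]_m => row_mx v b).
Proof.
move=> v; apply: rV_continuous => i; case: (split_ordP i) => j ->.
  have -> : (fun w : 'rV[R]_m => row_mx w b 0 (lshift n j)) = fun w => w 0 j.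
    by apply/funext => w; rewrite row_mxEl.
  exact: coord_continuous.
have -> : (fun w : 'rV[R]_m => row_mx w b 0 (rshift m j)) = fun=> b 0 j.
  by apply/funext => w; rewrite row_mxEr.
exact: cst_continuous.
Qed.

Lemma row_mx_affine m n (b : 'rV[R]_n) :
  coordinate_affine (fun v : 'rV[R]_m => row_mx v b).
Proof.
move=> i; left; exists (lshift n i) => v h.
apply/rowP => l; case: (split_ordP l) => j ->.
  by rewrite row_mxEl [RHS]mxE row_mxEl !mxE eqxx /= (inj_eq (@lshift_inj _ _)).
by rewrite row_mxEr [RHS]mxE row_mxEr !mxE eqxx /= eq_rlshift mulr0 add0r.
Qed.

Lemma Cinf_coord n (U : set 'rV[R]_n) i : Cinf U (fun v => v 0 i).
Proof.
suff : forall k, Ck k U (fun v : 'rV[R]_n => v 0 i) by [].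
have dq j v : (fun h : R => h^-1 *: ((h *: delta_mx 0 j + v) 0 i - v 0 i)) =
    fun h => h^-1 *: (h *: (delta_mx 0 j : 'rV[R]_n) 0 i).
  by apply/funext => h; rewrite !mxE addrK.
have cq (j : 'I_n) : (fun h : R => h^-1 *: (h *: (delta_mx 0 j : 'rV[R]_n) 0 i))
    @ 0^' --> (delta_mx 0 j : 'rV[R]_n) 0 i.
  (* The quotient is constant for [h != 0], which the punctured filter guarantees. *)
  apply: cvg_near_cst; near=> h; rewrite scalerA mulVf ?scale1r//.
  by near: h; exact: nbhs_dnbhs_neq.
case=> [|k] /=; first by move=> v _; exact: coord_continuous.
move=> j; split=> [v _|].
  rewrite /derivable dq; apply/cvg_ex.
  by exists ((delta_mx 0 j : 'rV[R]_n) 0 i).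
have -> : 'D_(delta_mx 0 j) (fun v : 'rV[R]_n => v 0 i) =
    fun=> (delta_mx 0 j : 'rV[R]_n) 0 i.
  by apply/funext => v; rewrite /derive dq; apply: cvg_lim; last exact: cq.
exact: Cinf_cst.
Unshelve. all: by end_near.
Qed.

(** The single chart has image the nonzero reals, where its transition map is the identity; the
    default of [insubd] occurs only at 0. *)
Lemma Rstar_smooth_atlas : smooth_atlas (Rstar_manifold (R := R)).
Proof.
split=> [_ -> x _ /=|_ _ -> -> /=]; first by rewrite mxE valKd.
have imE : (fun t : Rstar R => const_mx (val t) : 'rV[R]_1) @` (setT `&` setT) =
    (fun v => v 0 0) @^-1` [set x | x != 0].
  apply/seteqP; split=> [_ [t _ <-] /=|v v0]; first by rewrite mxE (valP t).
  by exists (exist _ (v 0 0) v0) => //; apply/rowP => i; rewrite mxE ord1.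
have Uo : open ((fun v : 'rV[R]_1 => v 0 0) @^-1` [set x | x != 0]).
  apply: open_comp; last exact: open_neq.
  by move=> v _; exact: coord_continuous.
rewrite imE; split=> // i.
apply: (Cinf_ext Uo _ (Cinf_coord _ 0)) => v /set_mem /= v0.
by rewrite mxE val_insubd v0.
Qed.

(** Transitions act blockwise: each coordinate is a transition coordinate of one factor composed
    with a block projection. *)
Lemma prod_smooth_atlas (M N : manifold R) :
  smooth_atlas M -> smooth_atlas N -> smooth_atlas (prod_manifold M N).
Proof.
move=> [Minv Mt] [Ninv Nt]; split.
  move=> _ [c [d [Mc Nd ->]]] [x y] [/= cx dy].
  by rewrite row_mxKl row_mxKr Minv// Ninv.
move=> _ _ [c [d [Mc Nd ->]]] [c' [d' [Mc' Nd' ->]]].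
have [cU cT] := Mt c c' Mc Mc'; have [dU dT] := Nt d d' Nd Nd'.
set U := cmap (prod_chart c d) @` _.
have UE : U = @lsubmx R 1 _ _ @^-1` (cmap c @` (cdom c `&` cdom c')) `&`
    @rsubmx R 1 _ _ @^-1` (cmap d @` (cdom d `&` cdom d')).
  apply/seteqP; split=> [_ [[x y] [[/= cx dy] [c'x d'y]] <-]|v].
    by rewrite /= row_mxKl row_mxKr; split; [exists x|exists y].
  move=> [[x [cx c'x] xv] [y [dy d'y] yv]]; exists (x, y) => //=.
  by rewrite xv yv hsubmxK.
have Uo : open U.
  rewrite UE; apply: openI; apply: open_comp => // v _.
    exact: continuous_lsubmx.
  exact: continuous_rsubmx.
split=> // i.
case: (split_ordP i) => j -> /=.
  apply: (Cinf_ext Uo (f := (fun v => cmap c' (cinv c v) 0 j) \o lsubmx)).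
    by move=> v _ /=; rewrite row_mxEl.
  apply: Cinf_subset (Cinf_comp_affine (@continuous_lsubmx _ _ _ _)
    (@lsubmx_affine _ _) (cT j)).
  by rewrite UE => v [].
apply: (Cinf_ext Uo (f := (fun v => cmap d' (cinv d v) 0 j) \o rsubmx)).
  by move=> v _ /=; rewrite row_mxEr.
apply: Cinf_subset (Cinf_comp_affine (@continuous_rsubmx _ _ _ _)
  (@rsubmx_affine _ _) (dT j)).
by rewrite UE => v [].
Qed.

Variable J : manifold R.

(** In charts, freezing [t] is composition with [row_mx v (const_mx (val t))]. It makes the chart
    formula of [L] applicable to slices. *)
Lemma smooth_slice (f : poissonization J -> R) t :
  smooth f -> smooth (slice f t).
Proof.
move=> fs x _.
have [_ [d [W [G [[[c [_ [Jc -> ->]]] [cx _]] Md [Wo Wx] Gs fG]]]]] :=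
  fs (x, t) I.
exists c, d, ((fun v => row_mx v (const_mx (val t))) @^-1` W),
  (fun v => G (row_mx v (const_mx (val t)))); split=> //.
- by split=> //; apply: open_comp => // v _; exact: row_mx_rV_continuous.
- move=> i; exact: Cinf_comp_affine (@row_mx_rV_continuous _ _ _)
    (@row_mx_affine _ _ _) (Gs i).
- by move=> y _ cy Wy; exact: (fG (y, t) I (conj cy I) Wy).
Qed.

Lemma smooth_poissonized_ham (H : J -> R) :
  smooth H -> smooth (poissonized_ham H).
Proof.
move=> Hs [x t] _.
have [c [d [W [G [[Jc cx] [-> _] [Wo Wx] Gs HG]]]]] := Hs x I.
exists (prod_chart c (Chart setT (fun t : Rstar R => const_mx (val t))
                    (fun v => insubd Rstar1 (v 0 0)))).
exists (Chart setT (fun x => const_mx x) (fun v => v 0 0)).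
exists (@lsubmx R 1 _ 1 @^-1` W).
(* The last coordinate is [t]; the other factor represents [H] in the chart of [J]. *)
exists (fun v : 'rV[R]_(mdim J + 1) =>
  const_mx (v 0 (rshift (mdim J) 0) * G (lsubmx v) 0 0)).
have Wo' : open (@lsubmx R 1 (mdim J) 1 @^-1` W).
  by apply: open_comp => // v _; exact: continuous_lsubmx.
split=> //.
- by split=> //; eexists; eexists; split; [exact: Jc|reflexivity|reflexivity].
- by split=> //; rewrite /= row_mxKl.
- move=> i; apply: (Cinf_ext Wo' (f := fun v : 'rV[R]_(mdim J + 1) =>
      v 0 (rshift (mdim J) 0) * ((fun w => G w 0 0) \o lsubmx) v)).
    by move=> v _; rewrite mxE.
  apply: Cinf_mul => //; first exact: Cinf_coord.
  exact: Cinf_comp_affine (@continuous_lsubmx _ _ _ _)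
    (@lsubmx_affine _ _) (Gs 0).
- move=> [y s] _ [cy _] /=; rewrite row_mxKl => Wy; split=> //.
  have [_ /= <-] := HG y I cy Wy.
  by rewrite row_mxEr !mxE.
Qed.

Lemma bivector_skew (L : op2 J) f g x : is_smooth_manifold J ->
  is_bivector_field L -> smooth f -> smooth g -> L f g x = - L g f x.
Proof.
move=> [cov _ _ _ _] Lb fs gs; have [c Jc cx] := cov x.
have [la [_ skew LE]] := Lb c Jc.
rewrite !LE// exchange_big -sumrN; apply: eq_bigr => i _.
rewrite -sumrN; apply: eq_bigr => j _.
by rewrite skew// !mulNr mulrAC.
Qed.

(** The first term inherits skewness from [L] on slices; the second is a 2 by 2 determinant in
    [partial_t] and [E]. *)
Lemma poisson_bivector_skew (L : op2 J) (E : op1 J) f g p :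
  is_smooth_manifold J -> is_bivector_field L -> smooth f -> smooth g ->
  poisson_bivector L E f g p = - poisson_bivector L E g f p.
Proof.
move=> Jman Lb fs gs; rewrite /poisson_bivector.
rewrite (bivector_skew _ Jman Lb (smooth_slice _ fs) (smooth_slice _ gs)).
ring.
Qed.

End Poissonization.

Theorem theorem2p10 (R : realType) (J : manifold R) (L : op2 J) (E : op1 J)
  (H : J -> R) (k : nat) (I : interval R)
  (phi : R -> diffeo J) (Phi : R -> diffeo (poissonization J))
  (Jman : is_smooth_manifold J) (LE : is_jacobi L E) (Hsmooth : smooth H)
  (k_ge1 : (1 <= k)%N)
  (phi_int : jacobi_hamiltonian_integrator L E I k H phi)
  (Phi_int : homogeneous_poisson_hamiltonian_integrator L E I k
               (poissonized_ham H) Phi)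
  (Phi_phi : covers I phi Phi) :
  [/\ (forall e, e \in I ->
         eq2 (push2 (Phi e) (poisson_bivector L E)) (poisson_bivector L E) /\
         (forall (z : Rstar R) (p : poissonization J),
            Phi e (hact z p) = hact z (Phi e p))),
      (forall p : poissonization J,
         littleo_pow I k
           (fun e => poissonized_ham H (Phi e p) - poissonized_ham H p)) &
      (forall C : poissonization J -> R,
         is_casimir (poisson_bivector L E) C ->
         forall p : poissonization J,
           littleo_pow I k (fun e => C (Phi e p) - C p))].
Proof.
have Patl : smooth_atlas (poissonization J).
  apply: prod_smooth_atlas; first exact: smooth_manifold_atlas.
  exact: Rstar_smooth_atlas.
have [Lb _ _ _] := LE.
have Hs := smooth_poissonized_ham Hsmooth.
have [[_ ord iso _] hom] := Phi_int.
split=> [e eI|p|C [Cs C0] p].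
- by split=> [|z p]; [exact: iso|exact: hom].
(* [Pi] evaluated on the pair of [poissonized_ham H] with itself equals its own opposite, hence is
   zero. *)
- apply: (has_order_first_integral p Patl Hs _ ord) => y; rewrite /poisson_ham.
  have := poisson_bivector_skew E y Jman Lb Hs Hs; lra.
(* The Casimir condition has [C] in the second slot, whereas [poisson_ham] applied to [C] puts it in
   the first; skew-symmetry exchanges them. *)
- apply: (has_order_first_integral p Patl Cs _ ord) => y; rewrite /poisson_ham.
  by rewrite poisson_bivector_skew// C0// oppr0.
Qed.
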